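(* Suppose $N\ge M^2+3M+3$, and let $\Phi$ be an $M\times N$ unit norm frame. Then linear-time flipping applied to $\Phi$ outputs an $M\times N$ frame $\Psi$ that is flipping equivalent to $\Phi$ and satisfies $\nu\le\frac{\mu}{\sqrt M}$, where $\mu$ and $\nu$ are the worst-case and average coherence of $\Psi$.
   Context: A unit norm frame is an $M\times N$ real or complex matrix $\Phi=[\varphi_1\cdots\varphi_N]$ of rank $M$ with unit-norm columns. The worst-case coherence is $\mu:=\max_{i\ne j}|\langle\varphi_i,\varphi_j\rangle|$ and the average coherence is $\nu:=\max_i\left|\frac1{N-1}\sum_{j\ne i}\langle\varphi_i,\varphi_j\rangle\right|$. Frames $\Phi$ and $\Psi$ are flipping equivalent if $\Psi=\Phi D$ for some diagonal matrix $D$ with diagonal entries in $\{+1,-1\}$. Linear-time flipping: set $\psi_1=\varphi_1$; for $n=2,\dots,N$, if $\left\|\sum_{i=1}^{n-1}\psi_i+\varphi_n\right\|\le\left\|\sum_{i=1}^{n-1}\psi_i-\varphi_n\right\|$ set $\psi_n=\varphi_n$, otherwise set $\psi_n=-\varphi_n$. Output $\Psi=[\psi_1\cdots\psi_N]$. *)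

(* Defs.v *)
From HB Require Import structures.
From mathcomp Require Import all_boot all_order all_algebra.
From mathcomp Require Import reals complex.
Set Implicit Arguments. Unset Strict Implicit. Unset Printing Implicit Defensive.
Import Order.TTheory GRing.Theory Num.Theory.
Local Open Scope ring_scope.

(* "Real or complex" is a case distinction on the scalars, so that every
   definition below is written once for both cases. *)
Variant scalar_kind := RealScalars | ComplexScalars.

Definition scalar_field (R : realType) (k : scalar_kind) : numFieldType :=
  match k with RealScalars => R | ComplexScalars => R[i] end.

Definition scalar_conj (R : realType) (k : scalar_kind) :
    scalar_field R k -> scalar_field R k :=
  match k with RealScalars => fun x => x | ComplexScalars => @conjc R end.

(* Unlike the norm of [R[i]], which is a complex number, the modulus takes its
   values in [R], where square roots and maxima make sense. *)
Definition modulus (R : realType) (k : scalar_kind) : scalar_field R k -> R :=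
  match k return scalar_field R k -> R with
  | RealScalars => fun x : R => `|x|
  | ComplexScalars => @Normc.normc R
  end.

Section Frames.
Variables (R : realType) (k : scalar_kind).
Local Notation K := (scalar_field R k).

Definition inner (M : nat) (x y : 'cV[K]_M) : K :=
  \sum_(i < M) x i 0 * scalar_conj (y i 0).

Definition l2norm (M : nat) (x : 'cV[K]_M) : R :=
  Num.sqrt (\sum_(i < M) modulus (x i 0) ^+ 2).

Definition unit_norm_frame (M N : nat) (Phi : 'M[K]_(M, N)) : Prop :=
  \rank Phi = M /\ forall j, l2norm (col j Phi) = 1.

(* The maxima range over nonnegative reals, so the default value 0 is only
   relevant when there is no pair of distinct indices, i.e. when N <= 1. *)
Definition worst_case_coherence (M N : nat) (Phi : 'M[K]_(M, N)) : R :=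
  \big[Num.max/0]_(i < N) \big[Num.max/0]_(j < N | j != i)
    modulus (inner (col i Phi) (col j Phi)).

Definition average_coherence (M N : nat) (Phi : 'M[K]_(M, N)) : R :=
  \big[Num.max/0]_(i < N)
    modulus ((N%:R - 1)^-1 * \sum_(j < N | j != i)
                               inner (col i Phi) (col j Phi)).

Definition flipping_equivalent (M N : nat) (Phi Psi : 'M[K]_(M, N)) : Prop :=
  exists d : 'rV[K]_N,
    (forall j, d 0 j = 1 \/ d 0 j = -1) /\ Psi = Phi *m diag_mx d.

(* [out] is the list psi_1, ..., psi_(n-1) produced so far, [phi] is phi_n. *)
Definition flip_step (M : nat) (out : seq 'cV[K]_M) (phi : 'cV[K]_M) :
    seq 'cV[K]_M :=
  let s := \sum_(psi <- out) psi in
  rcons out (if l2norm (s + phi) <= l2norm (s - phi) then phi else - phi).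

Definition flip_columns (M : nat) (phis : seq 'cV[K]_M) : seq 'cV[K]_M :=
  if phis is phi1 :: phis' then foldl (@flip_step M) [:: phi1] phis' else [::].

(* The default 0 of [nth] is never used: the output has N columns. *)
Definition linear_time_flipping (M N : nat) (Phi : 'M[K]_(M, N)) :
    'M[K]_(M, N) :=
  let psis := flip_columns [seq col j Phi | j <- enum 'I_N] in
  \matrix_(i < M, j < N) nth 0 psis j i 0.

End Frames.

(* Main.v *)
Require Import Defs.
From HB Require Import structures.
From mathcomp Require Import all_boot all_order all_algebra ring lra.
From mathcomp Require Import reals complex.
Set Implicit Arguments. Unset Strict Implicit. Unset Printing Implicit Defensive.
Import Order.TTheory GRing.Theory Num.Theory.
Local Open Scope ring_scope.

(** Two bounds on the output meet.

    Flipping keeps partial sums short: by the parallelogram law, the shorter of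
    [s + phi] and [s - phi] has squared norm at most [|s|^2 + |phi|^2], so each
    step adds at most 1, and the sum [s] of the [N] output columns satisfies
    [|s| <= sqrt N] ([l2norm_sum_flip_columns]).  Since the inner products of
    [psi_i] with the other columns add up to [<psi_i, s> - 1], Cauchy-Schwarz
    gives [nu <= (sqrt N + 1) / (N - 1)] ([average_coherence_le]).

    On the other side, [mu] cannot be small: the Welch bound
    [mu^2 >= (N - M) / (M (N - 1))] holds for any [N >= 2] unit vectors in
    dimension [M] ([welch_bound]).  It comes from the frame potential, the squared
    Frobenius norm of the Gram matrix.  The [M x M] frame operator has the same
    Frobenius norm and a diagonal adding up to [N], so the frame potential is at
    least [N^2 / M].

    With [t = sqrt N], the two bounds give [nu <= mu / sqrt M] as soon as
    [M^2 (t + 1) <= (t - 1) (t^2 - M)], a cubic inequality which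
    [t^2 >= M^2 + 3 M + 3] implies ([flipping_coherence_ineq]).

    Changing the signs of columns preserves the rank and the column norms, so
    the output is again a unit norm frame. *)

(** * Scalars: conjugation and modulus in the real and complex cases *)

Section Scalars.
Variables (R : realType) (k : scalar_kind).
Local Notation K := (scalar_field R k).

(** Identities about moduli are proved in the scalar field, where they are
    polynomial in a number and its conjugate, and come back to [R] by
    injectivity of this embedding. *)
Definition of_real : R -> K :=
  match k return R -> scalar_field R k with
  | RealScalars => id
  | ComplexScalars => real_complex R
  end.

Lemma of_real_is_zmod_morphism : zmod_morphism of_real.
Proof. by rewrite /of_real; case: k => x y //; apply: rmorphB. Qed.

Lemma of_real_is_monoid_morphism : monoid_morphism of_real.
Proof.
by rewrite /of_real; case: k; split => //= x y; apply: rmorphM.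
Qed.

HB.instance Definition _ :=
  GRing.isZmodMorphism.Build R K of_real of_real_is_zmod_morphism.
HB.instance Definition _ :=
  GRing.isMonoidMorphism.Build R K of_real of_real_is_monoid_morphism.

Lemma scalar_conj_is_zmod_morphism : zmod_morphism (@scalar_conj R k).
Proof. by rewrite /scalar_conj; case: k => x y //=; apply: rmorphB. Qed.

Lemma scalar_conj_is_monoid_morphism : monoid_morphism (@scalar_conj R k).
Proof.
rewrite /scalar_conj; case: k; split => //=; last exact: rmorphM.
exact: conjc1.
Qed.

HB.instance Definition _ :=
  GRing.isZmodMorphism.Build K K (@scalar_conj R k)
    scalar_conj_is_zmod_morphism.
HB.instance Definition _ :=
  GRing.isMonoidMorphism.Build K K (@scalar_conj R k)
    scalar_conj_is_monoid_morphism.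

Lemma scalar_conjK : involutive (@scalar_conj R k).
Proof. by rewrite /scalar_conj; case: k => x //=; exact: conjcK. Qed.

Lemma ler_of_real (a b : R) : (of_real a <= of_real b) = (a <= b).
Proof. by rewrite /of_real; case: k => //=; exact: lecR. Qed.

Lemma normr_modulus (x : K) : `|x| = of_real (modulus x).
Proof. by rewrite /of_real /modulus; case: k x => //= -[a b]. Qed.

Lemma mul_scalar_conj (x : K) : x * scalar_conj x = of_real (modulus x ^+ 2).
Proof.
rewrite rmorphXn /= -normr_modulus /scalar_conj.
case: k x => x /=; last by rewrite sqr_normc.
by rewrite -normrX ger0_norm ?sqr_ge0 // expr2.
Qed.

Lemma of_real_inj : injective of_real.
Proof. exact: fmorph_inj. Qed.

Lemma modulus_ge0 (x : K) : 0 <= modulus x.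
Proof. by rewrite -ler_of_real rmorph0 -normr_modulus. Qed.

Lemma modulus_sumr (I : Type) (r : seq I) (P : pred I) (F : I -> K) :
  modulus (\sum_(i <- r | P i) F i) <= \sum_(i <- r | P i) modulus (F i).
Proof.
rewrite -ler_of_real -normr_modulus rmorph_sum /=.
rewrite [leRHS](eq_bigr (fun i => `|F i|)) => [|i _].
  exact: ler_norm_sum.
by rewrite normr_modulus.
Qed.

Lemma modulusB (x y : K) : modulus (x - y) <= modulus x + modulus y.
Proof. by rewrite -ler_of_real rmorphD /= -!normr_modulus ler_normB. Qed.

Lemma modulusM (x y : K) : modulus (x * y) = modulus x * modulus y.
Proof. by apply: of_real_inj; rewrite rmorphM /= -!normr_modulus normrM. Qed.

Lemma modulusN (x : K) : modulus (- x) = modulus x.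
Proof. by apply: of_real_inj; rewrite -!normr_modulus normrN. Qed.

Lemma modulus_of_real (a : R) : 0 <= a -> modulus (of_real a) = a.
Proof.
move=> a0; apply: of_real_inj; rewrite -normr_modulus ger0_norm //.
by rewrite -(rmorph0 of_real) ler_of_real.
Qed.

Lemma modulus_conj (x : K) : modulus (scalar_conj x) = modulus x.
Proof.
have := congr1 (@scalar_conj R k) (mul_scalar_conj x).
rewrite rmorphM /= scalar_conjK mulrC mul_scalar_conj.
have := mul_scalar_conj (scalar_conj x); rewrite scalar_conjK mulrC.
rewrite mul_scalar_conj => /of_real_inj e _.
by apply/eqP; rewrite -(eqrXn2 (ltn0Sn 1)) ?modulus_ge0 // e.
Qed.

Lemma modulus_parallelogram (x y : K) :
  modulus (x + y) ^+ 2 + modulus (x - y) ^+ 2 =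
  2 * (modulus x ^+ 2 + modulus y ^+ 2).
Proof.
apply: of_real_inj; rewrite rmorphM !rmorphD /= rmorph1 -!mul_scalar_conj.
by rewrite rmorphB rmorphD /=; ring.
Qed.

End Scalars.

(** * Column vectors *)

(** Cauchy-Schwarz for finite families, from Lagrange's identity: the defect is
    half the sum of the squares of the 2 x 2 minors. *)
Lemma sum_mul_sqr_le (R : realFieldType) (n : nat) (a b : 'I_n -> R) :
  (\sum_i a i * b i) ^+ 2 <= (\sum_i a i ^+ 2) * (\sum_i b i ^+ 2).
Proof.
have h : 0 <= \sum_i \sum_j (a i * b j - a j * b i) ^+ 2.
  by apply: sumr_ge0 => i _; apply: sumr_ge0 => j _; apply: sqr_ge0.
suff e : \sum_i \sum_j (a i * b j - a j * b i) ^+ 2 =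
    2 * ((\sum_i a i ^+ 2) * (\sum_i b i ^+ 2) - (\sum_i a i * b i) ^+ 2).
  by rewrite e pmulr_rge0 // subr_ge0 in h.
transitivity (\sum_i \sum_j (a i ^+ 2 * b j ^+ 2 + b i ^+ 2 * a j ^+ 2
    - 2 * ((a i * b i) * (a j * b j)))).
  by apply: eq_bigr => i _; apply: eq_bigr => j _; ring.
transitivity (\sum_i (a i ^+ 2 * (\sum_j b j ^+ 2)
    + b i ^+ 2 * (\sum_j a j ^+ 2)
    - 2 * (a i * b i * \sum_j a j * b j))).
  by apply: eq_bigr => i _; rewrite sumrB big_split /= -!mulr_sumr.
rewrite sumrB big_split /= -!mulr_suml -mulr_sumr -mulr_suml; ring.
Qed.

Section Columns.
Variables (R : realType) (k : scalar_kind) (M : nat).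
Local Notation K := (scalar_field R k).
Implicit Types (x y : 'cV[K]_M).

Lemma l2norm_ge0 x : 0 <= l2norm x.
Proof. exact: sqrtr_ge0. Qed.

Lemma sqr_l2norm x : l2norm x ^+ 2 = \sum_(i < M) modulus (x i 0) ^+ 2.
Proof. by rewrite sqr_sqrtr // sumr_ge0 // => i _; apply: sqr_ge0. Qed.

Lemma l2normN x : l2norm (- x) = l2norm x.
Proof.
by congr Num.sqrt; apply: eq_bigr => i _; rewrite mxE modulusN.
Qed.

Lemma l2norm_parallelogram x y :
  l2norm (x + y) ^+ 2 + l2norm (x - y) ^+ 2 =
  2 * (l2norm x ^+ 2 + l2norm y ^+ 2).
Proof.
rewrite !sqr_l2norm -!big_split mulr_sumr /=.
by apply: eq_bigr => i _; rewrite !mxE modulus_parallelogram.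
Qed.

Lemma innerxx x : inner x x = of_real k (l2norm x ^+ 2).
Proof.
by rewrite sqr_l2norm rmorph_sum; apply: eq_bigr => i _; apply: mul_scalar_conj.
Qed.

Lemma inner_sumr (I : Type) (r : seq I) (P : pred I) x (F : I -> 'cV[K]_M) :
  inner x (\sum_(i <- r | P i) F i) = \sum_(i <- r | P i) inner x (F i).
Proof.
rewrite /inner exchange_big; apply: eq_bigr => a _ /=.
by rewrite summxE rmorph_sum mulr_sumr.
Qed.

(** The triangle inequality for the modulus reduces this to the families of
    moduli, so that only the real Cauchy-Schwarz inequality is needed. *)
Lemma modulus_inner_le x y : modulus (inner x y) <= l2norm x * l2norm y.
Proof.
apply: le_trans (modulus_sumr _ _ _) _.
rewrite -(@ler_pXn2r _ 2) // ?nnegrE; last 2 first.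
- by apply: sumr_ge0 => i _; apply: modulus_ge0.
- by rewrite mulr_ge0 ?l2norm_ge0.
rewrite exprMn !sqr_l2norm; apply: le_trans (sum_mul_sqr_le _ _).
rewrite (eq_bigr (fun i => modulus (x i 0) * modulus (y i 0))) // => i _.
by rewrite modulusM modulus_conj.
Qed.

End Columns.

(** * The flipping algorithm *)

Section Flipping.
Variables (R : realType) (k : scalar_kind) (M : nat).
Local Notation K := (scalar_field R k).
Implicit Types (s : seq 'cV[K]_M) (x : 'cV[K]_M).

(** The first column is not special: from an empty output the two candidates
    have equal norms, and the tie is resolved in favour of [phi_1].  This makes
    the algorithm a plain fold, suited to induction on the last column. *)
Lemma flip_columnsE s : flip_columns s = foldl (@flip_step R k M) [::] s.
Proof.
by case: s => //= x s; rewrite /flip_step big_nil add0r sub0r l2normN lexx.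
Qed.

Lemma flip_columns_rcons s x :
  flip_columns (rcons s x) = flip_step (flip_columns s) x.
Proof. by rewrite !flip_columnsE foldl_rcons. Qed.

Lemma size_flip_columns s : size (flip_columns s) = size s.
Proof.
elim/last_ind: s => // s x IHs.
by rewrite flip_columns_rcons !size_rcons IHs.
Qed.

Lemma nth_flip_columns s j :
  let psi := nth 0 (flip_columns s) j in
  psi = nth 0 s j \/ psi = - nth 0 s j.
Proof.
elim/last_ind: s => [|s x IHs] /=; first by left.
rewrite flip_columns_rcons !nth_rcons size_flip_columns.
case: ifP => // _; case: ifP => _; last by left.
by case: ifP; [left | right].
Qed.

(** In one step, [|s + phi|^2 + |s - phi|^2 = 2 (|s|^2 + 1)], so the smaller of
    the two terms is at most [|s|^2 + 1]. *)
Lemma l2norm_sum_flip_columns s :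
  (forall x, x \in s -> l2norm x = 1) ->
  l2norm (\sum_(psi <- flip_columns s) psi) ^+ 2 <= (size s)%:R.
Proof.
elim/last_ind: s => [_|s x IHs s1].
  rewrite big_nil sqr_l2norm big1 // => i _.
  by rewrite mxE -(rmorph0 (of_real k)) modulus_of_real // expr0n.
have /IHs {}IHs : forall y, y \in s -> l2norm y = 1.
  by move=> y ys; apply: s1; rewrite mem_rcons inE ys orbT.
have x1 : l2norm x = 1 by apply: s1; rewrite mem_rcons mem_head.
rewrite flip_columns_rcons size_rcons /flip_step big_rcons /=.
set t := \sum_(psi <- _) psi in IHs *.
have pm : l2norm (t + x) ^+ 2 + l2norm (t - x) ^+ 2 = 2 * (l2norm t ^+ 2 + 1).
  by rewrite l2norm_parallelogram x1 expr1n.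
have p0 := l2norm_ge0 (t + x); have m0 := l2norm_ge0 (t - x).
rewrite -natr1.
case: (leP (l2norm (t + x)) (l2norm (t - x))) => [le_pm|/ltW le_mp].
  by have := ler_pM p0 p0 le_pm le_pm; lra.
by have := ler_pM m0 m0 le_mp le_mp; lra.
Qed.

End Flipping.

(** * The Welch bound *)

Section Welch.
Variables (R : realType) (k : scalar_kind).
Local Notation K := (scalar_field R k).

Definition adjmx (m n : nat) (A : 'M[K]_(m, n)) : 'M[K]_(n, m) :=
  (map_mx (@scalar_conj R k) A)^T.

Lemma adjmxK m n (A : 'M[K]_(m, n)) : adjmx (adjmx A) = A.
Proof. by apply/matrixP => i j; rewrite !mxE scalar_conjK. Qed.

Lemma adjmxM m n p (A : 'M[K]_(m, n)) (B : 'M[K]_(n, p)) :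
  adjmx (A *m B) = adjmx B *m adjmx A.
Proof. by rewrite /adjmx map_mxM trmx_mul. Qed.

Lemma mxtrace_mul_adj m n (A : 'M[K]_(m, n)) :
  \tr (A *m adjmx A) = of_real k (\sum_i \sum_j modulus (A i j) ^+ 2).
Proof.
rewrite rmorph_sum; apply: eq_bigr => i _; rewrite mxE rmorph_sum.
by apply: eq_bigr => j _; rewrite !mxE mul_scalar_conj.
Qed.

(** With [A^*] the adjoint, both sides are traces, of the squares of [A A^*] and
    of [A^* A], and these agree by cyclicity of the trace. *)
Lemma frobenius_gram m n (A : 'M[K]_(m, n)) :
  \sum_i \sum_j modulus ((A *m adjmx A) i j) ^+ 2 =
  \sum_i \sum_j modulus ((adjmx A *m A) i j) ^+ 2.
Proof.
apply: (@of_real_inj R k); rewrite -!mxtrace_mul_adj !adjmxM !adjmxK.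
by rewrite -mulmxA mxtrace_mulC !mulmxA.
Qed.

(** The entries of the Gram matrix can be traded for those of the frame operator
    (up to conjugation, [S] in the proof), of size [M].  Keeping only its
    diagonal, whose sum is the sum of the squared column norms, Cauchy-Schwarz
    costs the factor [M]. *)
Lemma frame_potential_ge M N (Phi : 'M[K]_(M, N)) :
  (\sum_j l2norm (col j Phi) ^+ 2) ^+ 2 <=
  M%:R * \sum_i \sum_j modulus (inner (col i Phi) (col j Phi)) ^+ 2.
Proof.
(* The inner product is conjugate-linear in its second argument, so the
   Gram matrix with these entries is that of [Phi^T]. *)
have -> : \sum_i \sum_j modulus (inner (col i Phi) (col j Phi)) ^+ 2 =
    \sum_i \sum_j modulus ((Phi^T *m adjmx Phi^T) i j) ^+ 2.
  apply: eq_bigr => i _; apply: eq_bigr => j _; rewrite mxE.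
  by congr (modulus _ ^+ 2); apply: eq_bigr => a _; rewrite !mxE.
rewrite frobenius_gram; set S := adjmx _ *m _.
have -> : \sum_j l2norm (col j Phi) ^+ 2 = \sum_a 1 * modulus (S a a).
  under eq_bigr do rewrite sqr_l2norm.
  rewrite exchange_big; apply: eq_bigr => a _; rewrite mul1r.
  have -> : S a a = of_real k (\sum_j modulus (Phi a j) ^+ 2).
    rewrite mxE rmorph_sum; apply: eq_bigr => j _.
    by rewrite !mxE mulrC mul_scalar_conj.
  rewrite modulus_of_real; last by apply: sumr_ge0 => j _; apply: sqr_ge0.
  by apply: eq_bigr => j _; rewrite mxE.
apply: le_trans (sum_mul_sqr_le _ _) _.
rewrite expr1n sumr_const card_ord ler_wpM2l //.
apply: ler_sum => a _; rewrite (bigD1 a) //= lerDl.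
by apply: sumr_ge0 => b _; apply: sqr_ge0.
Qed.

Lemma modulus_inner_le_coherence M N (Phi : 'M[K]_(M, N)) i j : j != i ->
  modulus (inner (col i Phi) (col j Phi)) <= worst_case_coherence Phi.
Proof.
move=> ji; apply: (bigmax_sup i) => //.
exact: (le_bigmax_cond _ (fun j => modulus (inner (col i Phi) (col j Phi)))).
Qed.

Lemma worst_case_coherence_ge0 M N (Phi : 'M[K]_(M, N)) :
  0 <= worst_case_coherence Phi.
Proof. exact: bigmax_ge_id. Qed.

(** The frame potential of [N] unit vectors is at least [N^2 / M], and at most
    [N + N (N - 1) mu^2], the diagonal entries of the Gram matrix being 1. *)
Lemma welch_bound M N (Phi : 'M[K]_(M, N)) :
  (0 < N)%N -> (forall j, l2norm (col j Phi) = 1) ->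
  N%:R - M%:R <= M%:R * (N%:R - 1) * worst_case_coherence Phi ^+ 2.
Proof.
move=> N0 unitPhi; have := frame_potential_ge Phi.
rewrite (eq_bigr (fun=> 1)) => [|j _]; last by rewrite unitPhi expr1n.
rewrite sumr_const card_ord; set mu := worst_case_coherence Phi.
move=> /le_trans /(_ (_ : _ <= M%:R * (N%:R * (1 + (N%:R - 1) * mu ^+ 2)))) h.
have Ngt0 : 0 < N%:R :> R by rewrite ltr0n.
rewrite -(ler_pM2l Ngt0) -subr_ge0.
have -> : N%:R * (M%:R * (N%:R - 1) * mu ^+ 2) - N%:R * (N%:R - M%:R) =
  M%:R * (N%:R * (1 + (N%:R - 1) * mu ^+ 2)) - N%:R ^+ 2 by ring.
rewrite subr_ge0; apply: h; rewrite ler_wpM2l //.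
have -> : N%:R * (1 + (N%:R - 1) * mu ^+ 2) =
    \sum_(i < N) (1 + (N%:R - 1) * mu ^+ 2).
  by rewrite sumr_const card_ord mulr_natl.
apply: ler_sum => i _; rewrite (bigD1 i) //= innerxx unitPhi expr1n.
rewrite modulus_of_real // expr1n lerD2l.
apply: (@le_trans _ _ (\sum_(j < N | j != i) mu ^+ 2)).
  apply: ler_sum => j ji; rewrite lerXn2r ?nnegrE ?modulus_ge0 //.
    exact: worst_case_coherence_ge0.
  exact: modulus_inner_le_coherence.
rewrite sumr_const cardC1 card_ord -(mulr_natl _ N.-1) -subn1 natrB //.
Qed.

End Welch.

(** * From short sums to small average coherence *)

(** The inner products of a unit column with the other ones add up to its inner
    product with the sum of all columns, minus its squared norm 1. *)
Lemma average_coherence_le (R : realType) (k : scalar_kind) (M N : nat)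
    (Phi : 'M[scalar_field R k]_(M, N)) :
  (1 < N)%N -> (forall j, l2norm (col j Phi) = 1) ->
  average_coherence Phi <= (l2norm (\sum_j col j Phi) + 1) / (N%:R - 1).
Proof.
move=> N1 unitPhi; set s := \sum_j col j Phi.
have N1gt0 : 0 < N%:R - 1 :> R by rewrite subr_gt0 ltr1n.
apply: bigmax_le => [|i _].
  by apply: divr_ge0; [apply: addr_ge0 (l2norm_ge0 _) _ | exact: ltW].
have -> : (N%:R - 1)^-1 = of_real k ((N%:R - 1)^-1 : R).
  by rewrite fmorphV rmorphB /= rmorph_nat rmorph1.
rewrite modulusM modulus_of_real; last by rewrite invr_ge0 ltW.
rewrite [leLHS]mulrC ler_pM2r ?invr_gt0 //.
have -> : \sum_(j < N | j != i) inner (col i Phi) (col j Phi) =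
    inner (col i Phi) s - 1.
  rewrite inner_sumr [in RHS](bigD1 i) //= innerxx unitPhi expr1n rmorph1; ring.
apply: le_trans (modulusB _ _) _.
rewrite -(rmorph1 (of_real k)) modulus_of_real // lerD2r.
by apply: le_trans (modulus_inner_le _ _) _; rewrite unitPhi mul1r.
Qed.

(** The arithmetic of the two bounds, with [m = M], [r = sqrt M], [t = sqrt N].
    Clearing denominators, cancelling [t + 1] and squaring turn the goal into
    [m <= mu^2 (t - 1)^2]; multiplying by [m (t + 1)] brings in the Welch bound
    and leaves the cubic inequality [m^2 (t + 1) <= (t - 1) (t^2 - m)]. *)
Lemma flipping_coherence_ineq (R : realFieldType) (m r t mu : R) :
  1 <= m -> 0 <= r -> r ^+ 2 = m -> 0 <= t -> 0 <= mu ->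
  m ^+ 2 + 3 * m + 3 <= t ^+ 2 ->
  t ^+ 2 - m <= m * (t ^+ 2 - 1) * mu ^+ 2 ->
  (t + 1) / (t ^+ 2 - 1) <= mu / r.
Proof.
move=> m1 r0 rm t0 mu0 tm welch.
have r_gt0 : 0 < r by rewrite lt0r r0 andbT; apply/eqP => r00; nra.
(* [m^2 + 3 m + 3] exceeds [(m + 3/2)^2] by [3/4]. *)
have tm32 : m + 3 / 2 <= t by nra.
have poly : m * (m * (t + 1)) <= (t - 1) * (t ^+ 2 - m).
  have : (m + 3 / 2) * (t ^+ 2 - m - m ^+ 2) <= t * (t ^+ 2 - m - m ^+ 2).
    by rewrite ler_wpM2r //; nra.
  nra.
have key : r <= mu * (t - 1).
  rewrite -(@ler_pXn2r _ 2) // ?nnegrE; last by apply: mulr_ge0; lra.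
  rewrite rm -(@ler_pM2l _ (m * (t + 1))); last by apply: mulr_gt0; lra.
  have : (t - 1) * (t ^+ 2 - m) <= (t - 1) * (m * (t ^+ 2 - 1) * mu ^+ 2).
    by rewrite ler_wpM2l //; lra.
  have -> : m * (t + 1) * (mu * (t - 1)) ^+ 2 =
    (t - 1) * (m * (t ^+ 2 - 1) * mu ^+ 2) by ring.
  lra.
have -> : t ^+ 2 - 1 = (t + 1) * (t - 1) by ring.
rewrite ler_pdivlMr // mulrAC ler_pdivrMr; last by apply: mulr_gt0; lra.
rewrite mulrCA ler_pM2l //; lra.
Qed.

Theorem theorem70 (R : realType) (k : scalar_kind) (M N : nat)
    (Phi : 'M[scalar_field R k]_(M, N)) :
  (M ^ 2 + 3 * M + 3 <= N)%N ->
  unit_norm_frame Phi ->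
  let Psi := linear_time_flipping Phi in
  unit_norm_frame Psi /\
  flipping_equivalent Phi Psi /\
  average_coherence Psi <= worst_case_coherence Psi / Num.sqrt (M%:R : R).
Proof.
move=> MN [rankPhi unitPhi] Psi.
pose cols := [seq col j Phi | j <- enum 'I_N].
have size_cols : size cols = N by rewrite size_map size_enum_ord.
have nth_cols (j : 'I_N) : nth 0 cols j = col j Phi.
  by rewrite (nth_map j) ?size_enum_ord // nth_ord_enum.
have colPsi j : col j Psi = nth 0 (flip_columns cols) j.
  by apply/matrixP => i z; rewrite !mxE (ord1 z).
have flipPsi j : col j Psi = col j Phi \/ col j Psi = - col j Phi.
  by rewrite colPsi -nth_cols; apply: nth_flip_columns.
have unitPsi j : l2norm (col j Psi) = 1.
  by case: (flipPsi j) => ->; rewrite ?l2normN.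
pose d : 'rV[scalar_field R k]_N :=
  \row_j (if col j Psi == col j Phi then 1 else -1).
have d1 j : d 0 j = 1 \/ d 0 j = -1 by rewrite mxE; case: ifP; auto.
have PsiE : Psi = Phi *m diag_mx d.
  apply/matrixP => i j; rewrite mul_mx_diag [RHS]mxE [d 0 j]mxE.
  have entry (A : 'M[scalar_field R k]_(M, N)) : A i j = col j A i 0.
    by rewrite mxE.
  rewrite (entry Psi) (entry Phi).
  case: eqP (flipPsi j) => [-> _|_ [//|->]]; first by rewrite mulr1.
  by rewrite mxE mulrN1.
have unit_d : diag_mx d \in unitmx.
  rewrite unitmxE det_diag unitfE; apply/prodf_neq0 => j _.
  by case: (d1 j) => ->; rewrite ?oppr_eq0 oner_eq0.
split; first by split=> //; rewrite PsiE mxrankMfree // row_free_unit.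
split; first by exists d.
have N3 : (3 <= N)%N by apply: leq_trans MN; apply: leq_addl.
have N1 : (1 < N)%N by apply: leq_trans N3.
have M0 : (0 < M)%N.
  (* A column of height 0 has norm 0. *)
  rewrite lt0n; apply/eqP => M0; have := unitPhi (Ordinal N3).
  rewrite /l2norm big1 => [|i _]; last by have := ltn_ord i; rewrite {2}M0.
  by rewrite sqrtr0 => /esym/eqP; rewrite oner_eq0.
have sum_norm : l2norm (\sum_j col j Psi) <= Num.sqrt N%:R.
  rewrite -(ger0_norm (l2norm_ge0 _)) -sqrtr_sqr ler_wsqrtr //.
  have -> : \sum_j col j Psi = \sum_(psi <- flip_columns cols) psi.
    rewrite (big_nth 0) size_flip_columns size_cols big_mkord.
    by apply: eq_bigr => j _; rewrite colPsi.
  rewrite -[in N%:R]size_cols; apply: l2norm_sum_flip_columns => x.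
  by case/mapP => j _ ->.
apply: le_trans (average_coherence_le N1 unitPsi) _.
have sqrN : Num.sqrt N%:R ^+ 2 = N%:R :> R by rewrite sqr_sqrtr.
apply: (@le_trans _ _ ((Num.sqrt N%:R + 1) / (N%:R - 1))).
  by rewrite ler_wpM2r ?lerD2r // invr_ge0 subr_ge0 ler1n ltnW.
rewrite -[X in _ / (X - 1)]sqrN.
apply: (@flipping_coherence_ineq _ M%:R); rewrite ?sqrtr_ge0 ?ler1n //.
- by rewrite sqr_sqrtr.
- exact: worst_case_coherence_ge0.
- by rewrite sqrN -natrX -natrM -!natrD ler_nat.
- by rewrite sqrN; apply: welch_bound unitPsi; apply: ltnW.
Qed.
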